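(* Let $f_0,f_1,f_2:\mathbb{C}\to\mathbb{C}$ be maps of the form $f_k(z)=\frac12\, s_k(z+c_k)$, where each $c_k=a_k+i b_k$ with $a_k,b_k\in\mathbb{Z}$ and each $s_k$ is one of the four rotations $z\mapsto z,\ z\mapsto iz,\ z\mapsto -z,\ z\mapsto -iz$. Let $A\subset\mathbb{C}$ be the self-similar set with respect to $f_0,f_1,f_2$, and let $U_c$ be its central open set. If $V\subseteq U_c$ is a non-empty open set, then the union $$U=\bigcup_{\ell} f_{\ell}(V),$$ taken over all words $\ell$ of arbitrary length over $\{0,1,2\}$ (including the empty word), is an open set which satisfies $$f_j(U)\subset U\quad\text{and}\quad f_j(U)\cap f_k(U)=\emptyset\qquad\text{for all } j,k\in\{0,1,2\}\text{ with } j\neq k.$$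
   Context: The self-similar set with respect to $f_0,f_1,f_2$ is the unique non-empty compact set $A\subset\mathbb{C}$ with $A=f_0(A)\cup f_1(A)\cup f_2(A)$. A word of length $n$ is a tuple $\mathbf{j}=(j_1,\dots,j_n)$ with entries in $\{0,1,2\}$; it denotes the composition $f_{\mathbf{j}}=f_{j_1}\circ f_{j_2}\circ\cdots\circ f_{j_n}$ (for the empty word, $f_{\mathbf{j}}$ is the identity). A neighbor map is a map of the form $h=f_{\mathbf{j}}^{-1}\circ f_{\mathbf{k}}$, where $\mathbf{j}=(j_1,\dots,j_n)$ and $\mathbf{k}=(k_1,\dots,k_n)$ are words of the same length $n\ge 1$ with $j_1\neq k_1$. For a point $z\in\mathbb{C}$ and a non-empty set $B\subset\mathbb{C}$, $d(z,B)=\inf\{|z-b| : b\in B\}$. The central open set is $$U_c=\{z\in\mathbb{C} : d(z,A)<d(z,h(A))\ \text{for every neighbor map } h\}.$$ *)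

(* Defs.v *)
From HB Require Import structures.
From mathcomp Require Import all_boot all_order all_algebra.
From mathcomp Require Import boolp classical_sets functions reals.
From mathcomp Require Import topology normedtype.
From mathcomp Require Import complex.

Set Implicit Arguments.
Unset Strict Implicit.
Unset Printing Implicit Defensive.

Import Order.TTheory GRing.Theory Num.Theory numFieldNormedType.Exports.
Local Open Scope classical_set_scope.
Local Open Scope ring_scope.
Local Open Scope complex_scope.

Definition quarter_turn (R : realType) (s : R[i] -> R[i]) : Prop :=
  [\/ s = (fun z => z), s = (fun z => 'i%C * z),
      s = (fun z => - z) | s = (fun z => - 'i%C * z)].

(* C is modelled as R[i].  Its topology is carried by the alias R[i]^o (norm topology of the
   numFieldType R[i]); R[i] itself has no topological structure.  By
   Hutchinson's theorem exactly one set satisfies this predicate when the maps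
   are contractions. *)
Definition self_similar_set (R : realType) (f : 'I_3 -> R[i] -> R[i])
    (A : set R[i]) : Prop :=
  [/\ A !=set0, @compact (R[i])^o A & A = \bigcup_(k : 'I_3) (f k @` A)].

Definition word_map (R : realType) (f : 'I_3 -> R[i] -> R[i])
    (w : seq 'I_3) : R[i] -> R[i] :=
  foldr (fun k g => f k \o g) id w.

(* g is the two-sided inverse of word_map f j. *)
Definition neighbor_map (R : realType) (f : 'I_3 -> R[i] -> R[i])
    (h : R[i] -> R[i]) : Prop :=
  exists (n : nat) (j k : n.+1.-tuple 'I_3) (g : R[i] -> R[i]),
    [/\ thead j != thead k,
        cancel (word_map f j) g, cancel g (word_map f j)
      & h = g \o word_map f k].

(* Normc.normc is the modulus with values in R, where inf lives; `|z| would be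
   an element of R[i]. *)
Definition dist_set (R : realType) (z : R[i]) (B : set R[i]) : R :=
  inf [set Normc.normc (z - b) | b in B].

Definition central_open_set (R : realType) (f : 'I_3 -> R[i] -> R[i])
    (A : set R[i]) : set R[i] :=
  [set z | forall h, neighbor_map f h -> dist_set z A < dist_set z (h @` A)].

(* Main.v *)
Require Import Defs.
From HB Require Import structures.
From mathcomp Require Import all_boot all_order all_algebra.
From mathcomp Require Import boolp classical_sets functions reals.
From mathcomp Require Import topology normedtype.
From mathcomp Require Import complex.

Set Implicit Arguments.
Unset Strict Implicit.
Unset Printing Implicit Defensive.

Import Order.TTheory GRing.Theory Num.Theory numFieldNormedType.Exports.
Local Open Scope classical_set_scope.
Local Open Scope ring_scope.
Local Open Scope complex_scope.

(** Since all the [f_k] are similarities of one common ratio, applying [f_u] to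
    the inequality defining the central open set shows that a point of [f_u(V)]
    is strictly nearer to [f_u(A)] than to [f_v(A)] for every word [v] of the
    same length with another first letter. If [f_u(p) = f_v(q)] with [size u <=
    size v], cut [v] down to the length of [u], and extend [u] to the length of
    [v] along a nearest piece of [f_u(A)]; the two strict inequalities so
    obtained contradict each other. *)

Section DistSet.
Variable R : realType.
Implicit Types (z : R[i]) (B C : set R[i]).

Lemma normc_ge0 z : 0 <= Normc.normc z.
Proof. by case: z => x y; exact: sqrtr_ge0. Qed.

Lemma normc_gt0 z : z != 0 -> 0 < Normc.normc z.
Proof.
move=> z0; rewrite lt_neqAle normc_ge0 andbT eq_sym.
by apply: contra z0 => /eqP/Normc.eq0_normc ->.
Qed.

Lemma dist_set_le z B b : B b -> dist_set z B <= Normc.normc (z - b).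
Proof.
move=> Bb; apply: ge_inf; last by exists b.
by exists 0 => _ [c _ <-]; exact: normc_ge0.
Qed.

(** Nonemptiness matters: [inf] of the empty set is the default value 0, which would break the bound
    for positive [r]. *)
Lemma le_dist_set z B r : B !=set0 ->
  (forall b, B b -> r <= Normc.normc (z - b)) -> r <= dist_set z B.
Proof.
move=> [b0 Bb0] le_r; apply: lb_le_inf; first by exists (Normc.normc (z - b0)), b0.
by move=> _ [b Bb <-]; exact: le_r.
Qed.

Lemma dist_set_subset z B C : B !=set0 -> B `<=` C -> dist_set z C <= dist_set z B.
Proof. by move=> B0 BC; apply: le_dist_set => // b /BC; exact: dist_set_le. Qed.

(** Among finitely many pieces one has minimal distance, and each point of the union lies in a piece
    at least that far away. *)
Lemma dist_set_bigcup z n (B : 'I_n.+1 -> set R[i]) :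
  \bigcup_k B k !=set0 -> exists k, dist_set z (B k) <= dist_set z (\bigcup_k B k).
Proof.
move=> UB0; case: (@arg_minP _ _ _ ord0 predT (fun k => dist_set z (B k))) => // k _ mink.
exists k; apply: le_dist_set => // b [l _ Blb].
exact: le_trans (mink l isT) (dist_set_le _ Blb).
Qed.

Lemma dist_set_affine (al be : R[i]) z B : al != 0 -> B !=set0 ->
  dist_set (al * z + be) ((fun x => al * x + be) @` B) = Normc.normc al * dist_set z B.
Proof.
move=> al0 B0; have nal := normc_gt0 al0.
have normE b : Normc.normc (al * z + be - (al * b + be)) =
    Normc.normc al * Normc.normc (z - b).
  by rewrite -Normc.normcM mulrBr opprD addrACA subrr addr0.
apply/eqP; rewrite eq_le; apply/andP; split.
  rewrite -ler_pdivrMl//; apply: le_dist_set => // b Bb.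
  by rewrite ler_pdivrMl// -normE; apply: dist_set_le; exists b.
apply: le_dist_set; first by case: B0 => b Bb; exists (al * b + be), b.
by move=> _ [b Bb <-]; rewrite normE ler_pM2l// dist_set_le.
Qed.

End DistSet.

Section Words.
Variables (R : realType) (f : 'I_3 -> R[i] -> R[i]).
Implicit Types (u v w : seq 'I_3) (A : set R[i]).

Lemma word_map_cat u v : word_map f (u ++ v) = word_map f u \o word_map f v.
Proof. by elim: u => //= k u ->. Qed.

Lemma word_map_subset A w :
  A = \bigcup_k (f k @` A) -> word_map f w @` A `<=` A.
Proof.
move=> AE; elim: w => [|k w IHw] _ [x Ax <-] //=.
by rewrite AE; exists k => //; exists (word_map f w x) => //; apply: IHw; exists x.
Qed.

(** Built letter by letter: self-similarity splits the current piece into three subpieces, one of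
    which is as near to [z] as the piece itself. *)
Lemma nearest_word A z u n : A !=set0 -> A = \bigcup_k (f k @` A) ->
  exists2 w, size w = n &
    dist_set z (word_map f (u ++ w) @` A) <= dist_set z (word_map f u @` A).
Proof.
move=> A0 AE; elim: n => [|n [w sw le_w]]; first by exists [::]; rewrite ?cats0.
have imE : word_map f (u ++ w) @` A =
    \bigcup_k (word_map f (u ++ rcons w k) @` A).
  rewrite {1}AE image_bigcup; apply: eq_bigcupr => k _.
  by rewrite -cats1 catA (word_map_cat (u ++ w)) image_comp.
have [|k le_k] := @dist_set_bigcup _ z _ (fun k => word_map f (u ++ rcons w k) @` A).
  by rewrite -imE; case: A0 => x Ax; exists (word_map f (u ++ w) x), x.
exists (rcons w k); first by rewrite size_rcons sw.
by apply: le_trans le_k _; rewrite -imE.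
Qed.

Variable r : R.
Hypothesis f_affine : forall k, exists al be : R[i],
  [/\ al != 0, Normc.normc al = r & f k = fun z => al * z + be].

Lemma word_map_affine w : exists al be : R[i],
  [/\ al != 0, Normc.normc al = r ^+ size w & word_map f w = fun z => al * z + be].
Proof.
elim: w => [|k w [al [be [al0 nal fw]]]] /=.
  exists 1, 0; split; rewrite ?oner_eq0 ?Normc.normc1 //.
  by apply/funext => z; rewrite mul1r addr0.
have [al' [be' [al'0 nal' fk]]] := f_affine k.
exists (al' * al), (al' * be + be'); split; first by rewrite mulf_neq0.
  by rewrite Normc.normcM nal nal' exprS.
by apply/funext => z; rewrite fw fk /= mulrDr mulrA addrA.
Qed.

(** The image under an invertible affine map is the preimage under its continuous inverse. *)
Lemma open_word_map w (V : set R[i]) :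
  @open (R[i])^o V -> @open (R[i])^o (word_map f w @` V).
Proof.
have [al [be [al0 _ ->]]] := word_map_affine w => Vo.
pose g : (R[i])^o -> (R[i])^o := fun z => al^-1 * (z - be).
have -> : (fun z => al * z + be) @` V = g @^-1` V.
  rewrite /g; apply/seteqP; split => [_ [x Vx <-]|x Vx] /=.
    by rewrite addrK mulKf.
  by exists (al^-1 * (x - be)); rewrite ?mulVKf ?subrK.
apply: (@open_comp (R[i])^o (R[i])^o g V) => // x _.
apply: (@continuousM R[i] (R[i])^o (cst al^-1) (fun z : (R[i])^o => z - be : (R[i])^o)).
  exact: cst_continuous.
by apply: continuousB; [exact: cvg_id|exact: cst_continuous].
Qed.

(** Equal lengths and distinct first letters make $f_{ju}^{-1} f_{kv}$ a neighbor map; applying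
    $f_{ju}$ to its inequality at [p] multiplies both distances by the same positive factor. *)
Lemma central_word_lt A p j k u v : A !=set0 -> central_open_set f A p ->
  j != k -> size u = size v ->
  dist_set (word_map f (j :: u) p) (word_map f (j :: u) @` A) <
  dist_set (word_map f (j :: u) p) (word_map f (k :: v) @` A).
Proof.
move=> A0 Ap jk suv.
have [al [be [al0 nal fu]]] := word_map_affine (j :: u).
pose g z : R[i] := al^-1 * (z - be).
have fgK : cancel (word_map f (j :: u)) g.
  by move=> z; rewrite fu /g addrK mulKf.
have gfK : cancel g (word_map f (j :: u)).
  by move=> z; rewrite fu /g mulVKf// subrK.
have nbr : neighbor_map f (g \o word_map f (k :: v)).
  have su : size (j :: u) == (size v).+1 by rewrite /= suv.
  have sv : size (k :: v) == (size v).+1 by [].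
  by exists (size v), (Tuple su), (Tuple sv), g; split.
(* Both sets are now images under $f_{ju}$, so the scaling rule applies to each side. *)
have -> : word_map f (k :: v) @` A =
    word_map f (j :: u) @` ((g \o word_map f (k :: v)) @` A).
  by rewrite image_comp; apply: eq_imagel => x _; exact: esym (gfK _).
rewrite fu !dist_set_affine//; last by case: A0 => x Ax; exists ((g \o word_map f (k :: v)) x), x.
by rewrite ltr_pM2l ?normc_gt0//; exact: Ap.
Qed.

Lemma word_map_central_neq A p q j k u v :
  A !=set0 -> A = \bigcup_k (f k @` A) ->
  central_open_set f A p -> central_open_set f A q -> j != k ->
  word_map f (j :: u) p <> word_map f (k :: v) q.
Proof.
move=> A0 AE; wlog suv : p q j k u v / (size u <= size v)%N.
  move=> H Ap Aq jk; have [suv|/ltnW svu] := leqP (size u) (size v).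
    exact: H.
  by move=> /esym; apply: H => //; rewrite eq_sym.
move=> Ap Aq jk eqpq; set x := word_map f (j :: u) p in eqpq.
(* This length makes [j :: (u ++ w)] as long as [k :: v]; the subtraction is not truncated, by
   [suv]. *)
have [w sw le_w] := nearest_word x (j :: u) (size v - size u) A0 AE.
have lt_v : dist_set x (word_map f (k :: v) @` A) <
    dist_set x (word_map f (j :: (u ++ w)) @` A).
  (* Reading [x] as $f_{kv}(q)$ lets the centrality of [q] be used, with the two words in exchanged
     roles. *)
  rewrite eqpq; apply: central_word_lt => //; first by rewrite eq_sym.
  by rewrite size_cat sw subnKC.
have lt_u : dist_set x (word_map f (j :: u) @` A) <
    dist_set x (word_map f (k :: take (size u) v) @` A).
  by apply: central_word_lt => //; rewrite size_takel.
have le_v : dist_set x (word_map f (k :: take (size u) v) @` A) <=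
    dist_set x (word_map f (k :: v) @` A).
  apply: dist_set_subset.
    by case: A0 => y Ay; exists (word_map f (k :: v) y), y.
  (* The letters cut off from [v] map [A] into itself, so the longer word gives a smaller piece. *)
  rewrite -{1}(cat_take_drop (size u) v) -cat_cons word_map_cat -image_comp.
  by apply: image_subset; exact: word_map_subset.
(* The chain starts and ends at the distance from [x] to $f_{ju}(A)$, which would be less than
   itself. *)
have := lt_le_trans lt_u (le_trans le_v (le_trans (ltW lt_v) le_w)).
by rewrite ltxx.
Qed.

End Words.

(** Each quarter turn is multiplication by some [t] of modulus 1, which gives slope $t/2$ and
    constant term $tc/2$. *)
Lemma half_quarter_turn_affine (R : realType) (s : R[i] -> R[i]) (c : R[i]) :
  quarter_turn s -> exists al be : R[i],
  [/\ al != 0, Normc.normc al = 2^-1 & (fun z => 2^-1 * s (z + c)) = fun z => al * z + be].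
Proof.
have unit_turn (t : R[i]) : Normc.normc t = 1 -> s =1 *%R t -> exists al be : R[i],
    [/\ al != 0, Normc.normc al = 2^-1
      & (fun z => 2^-1 * s (z + c)) = fun z => al * z + be].
  move=> nt sE; exists (2^-1 * t), (2^-1 * t * c); split.
  - rewrite mulf_neq0 ?invr_eq0 ?pnatr_eq0//; apply/eqP => t0.
    by move: nt; rewrite t0 Normc.normc0 => /esym/eqP; rewrite oner_eq0.
  - have n2 : Normc.normc (2 : R[i]) = 2 by rewrite -[2]/(1 *+ 2) normcMn Normc.normc1.
    (* The modulus of $1/2$ follows from $|2|\,|1/2| = |1| = 1$. *)
    rewrite Normc.normcM nt mulr1; apply: (mulfI (x := 2)); first by rewrite pnatr_eq0.
    by rewrite -{1}n2 -Normc.normcM !divff ?pnatr_eq0// Normc.normc1.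
  - by apply/funext => z; rewrite sE mulrA mulrDr.
have ni : Normc.normc ('i%C : R[i]) = 1 by rewrite /= expr0n expr1n add0r sqrtr1.
case=> sE.
- by apply: (unit_turn 1) => [|z]; rewrite ?Normc.normc1 // sE mul1r.
- by apply: (unit_turn 'i%C) => // z; rewrite sE.
- by apply: (unit_turn (- 1)) => [|z]; rewrite ?normcN ?Normc.normc1 // sE mulN1r.
- by apply: (unit_turn (- 'i%C)) => [|z]; rewrite ?normcN // sE.
Qed.

Theorem proposition1 (R : realType) (a b : 'I_3 -> int)
    (s f : 'I_3 -> R[i] -> R[i]) (A V : set R[i])
    (hs : forall k, quarter_turn (s k))
    (hf : forall k z, f k z = 2^-1 * s k (z + ((a k)%:~R +i* (b k)%:~R)))
    (hA : self_similar_set f A)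
    (hV0 : V !=set0) (hVo : @open (R[i])^o V)
    (hVU : V `<=` central_open_set f A) :
  let U : set R[i] := \bigcup_(w : seq 'I_3) (word_map f w @` V) in
  [/\ @open (R[i])^o U,
      forall j, f j @` U `<=` U
    & forall j k, j != k -> f j @` U `&` f k @` U = set0].
Proof.
have [A0 _ AE] := hA.
have f_affine k : exists al be : R[i],
    [/\ al != 0, Normc.normc al = 2^-1 & f k = fun z => al * z + be].
  rewrite (_ : f k = fun z => 2^-1 * s k (z + ((a k)%:~R +i* (b k)%:~R))).
    exact: half_quarter_turn_affine.
  exact/funext/hf.
move=> U; split=> [|j _ [_ [w _ [p Vp <-]] <-]|j k jk].
- by apply: bigcup_open => w _; exact: open_word_map f_affine _ _ hVo.
- by exists (j :: w) => //; exists p.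
(* A common point would be $f_{ju}(p) = f_{kv}(q)$ with [p] and [q] central. *)
- apply/seteqP; split=> // _ [[_ [u _ [p Vp <-]] <-] [_ [v _ [q Vq <-]]]] /esym eqjk.
  by case: (word_map_central_neq f_affine A0 AE (hVU _ Vp) (hVU _ Vq) jk eqjk).
Qed.
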